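(* Let $(X,M)$ be a symmetric generalised uniform space. The localic completion $\mathcal U(X)$ embeds into the product $\prod_{d\in M}\mathcal M(X,d)$ of formal topologies as an overt weakly closed subtopology; that is, there are a splitting subset $V$ of the base of $\prod_{d\in M}\mathcal M(X,d)$ and an embedding $\mathcal U(X)\to\prod_{d\in M}\mathcal M(X,d)$ whose image is the overt weakly closed subtopology of $\prod_{d\in M}\mathcal M(X,d)$ determined by $V$.
   Context: Foundations: constructive (Aczel's CZF with the Regular Extension Axiom; neither excluded middle nor choice is assumed). $\mathrm{Pow}(S)$ is the class of subsets of $S$; $\mathrm{Fin}(S)$ is the set of finitely enumerable subsets of $S$ (images of $\{0,\dots,n-1\}$). For a relation $r\subseteq S\times T$ and $D\subseteq T$, $r^-D=\{a\in S\mid \exists b\in D,\ a\,r\,b\}$ and $r^-b=r^-\{b\}$. Formal topologies: a formal topology is $\mathcal S=(S,\lhd,\le)$ with $(S,\le)$ a preordered set and $\lhd$ a relation between $S$ and $\mathrm{Pow}(S)$ (a cover) such that $\{a\mid a\lhd U\}$ is a set for each $U\subseteq S$ and, for all $a,b\in S$, $U,V\subseteq S$: (1) $U\lhd U$; (2) $a\lhd U$ and $U\lhd V$ imply $a\lhd V$; (3) $a\lhd U$ and $a\lhd V$ imply $a\lhd U\downarrow V$; (4) $a\le b$ implies $a\lhd b$. Here $U\lhd V$ means $\forall a\in U\ (a\lhd V)$, $U\downarrow V=\{c\mid\exists a\in U\,\exists b\in V\ (c\le a,\ c\le b)\}$, and singletons are written as elements. A formal topology map $r\colon\mathcal S\to\mathcal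 S'$ is a relation $r\subseteq S\times S'$ with $S\lhd r^-S'$; $r^-a\downarrow r^-b\lhd r^-(a\downarrow' b)$; $a\lhd' U\Rightarrow r^-a\lhd r^-U$. Two maps $r,s$ are equal if $r^-a\lhd s^-a$ and $s^-a\lhd r^-a$ for all $a\in S'$. Composition is composition of relations. The cover inductively generated on a preorder by given axioms $a\lhd C$ is the least cover (making the preorder a formal topology) that satisfies the axioms. Subtopologies: a subtopology of $\mathcal S=(S,\lhd,\le)$ is a formal topology $(S,\lhd',\le)$ with $a\lhd U\Rightarrow a\lhd'U$. The image of $\mathcal S$ under $r\colon\mathcal S\to\mathcal S'$ is the subtopology $\mathcal S_r=(S',\lhd_r,\le')$ of $\mathcal S'$ where $a\lhd_rU$ iff $r^-a\lhd r^-U$. The map $r$ is an embedding if it restricts to an isomorphism between $\mathcal S$ and $\mathcal S_r$. A subset $V\subseteq S$ is splitting if $a\in V$ and $a\lhd U$ imply that $V\cap U$ is inhabited. For an inductively generated $\mathcal S$ and a splitting $V\subseteq S$, the overt weakly closed subtopology $\mathcal S_V$ determined by $V$ is the formal topology on $(S,\le)$ whose cover is inductively generated by the axioms of $\mathcal S$ together with $a\lhd_VV\cap\{a\}$ for each $a\in S$. Product of a set-indexed family $\mathcal S_i=(S_i,\lhd_i,\le_i)$ $(i\in I)$, with $\lhd_i$ inductively generated by axioms $a\lhd_iC_i(a,k)$ $(a\in S_i,k\in K_i(a))$: base $S_\Pi=\mathrm{Fin}(\sum_iS_i)$, ordered by $A\le_\Pi B$ iff $\forall(i,b)\in B\,\exists(j,a)\in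 A\ (i=j,\ a\le_ib)$, with cover inductively generated by: $A\lhd_\Pi\{\{(i,a)\}\mid a\in S_i\}$ for each $A\in S_\Pi$, $i\in I$; $\{(i,a),(i,b)\}\lhd_\Pi\{\{(i,c)\}\mid c\le_ia,\ c\le_ib\}$; and $\{(i,a)\}\lhd_\Pi\{\{(i,b)\}\mid b\in C_i(a,k)\}$. Upper reals: $\mathbb R^u$ is the class of subsets $U\subseteq\mathbb Q^{>0}$ with $q\in U\iff\exists q'<q\,(q'\in U)$ (possibly empty). $U\le V$ iff $V\subseteq U$; $U+V=\{q_1+q_2\mid q_1\in U,q_2\in V\}$; a non-negative rational $r$ is identified with $\{q\mid r<q\}$; $U<V$ iff $U+r\le V$ for some $r\in\mathbb Q^{>0}$ (so $U<q\iff q\in U$). Generalised uniform spaces: a generalised metric on $X$ is $d\colon X\times X\to\mathbb R^u$ with $d(x,x)=0$ and $d(x,z)\le d(x,y)+d(y,z)$; generalised metrics are ordered pointwise; $d$ is symmetric if $d(x,y)=d(y,x)$. A generalised uniform space (gus) is $(X,M)$ with $M$ a set of generalised metrics on $X$ that is inhabited and closed under binary sups; it is symmetric if each $d\in M$ is. Localic completion: for a gus $(X,M)$ let $U_X=M\times\mathbb Q^{>0}\times X$, with elements written $\mathsf b_d(x,\varepsilon)$. Put $\mathsf b_d(y,\delta)\le_X\mathsf b_\rho(x,\varepsilon)$ iff $\rho\le d$ and $\rho(x,y)+\delta\le\varepsilon$; and $\mathsf b_d(y,\delta)<_X\mathsf b_\rho(x,\varepsilon)$ iff $\rho\le d$ and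 $\rho(x,y)+\delta<\varepsilon$. $\mathcal U(X)=(U_X,\lhd_X,\le_X)$ where $\lhd_X$ is inductively generated by the axioms, for all $a\in U_X$: (U1) $a\lhd_X\{b\mid b<_Xa\}$; (U2) $a\lhd_X\mathcal C_d^\varepsilon$ for each $d\in M$, $\varepsilon\in\mathbb Q^{>0}$, where $\mathcal C_d^\varepsilon=\{\mathsf b_d(x,\varepsilon)\mid x\in X\}$. For a single generalised metric $d$, $\mathcal M(X,d)$ denotes $\mathcal U(X,\{d\})$. *)

(* Defs.v *)
From mathcomp Require Import all_boot all_order all_algebra.
From mathcomp Require Import boolp classical_sets.
From mathcomp Require Import ring lra.

Set Implicit Arguments.
Unset Strict Implicit.
Unset Printing Implicit Defensive.

Import Order.TTheory GRing.Theory Num.Theory.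

Local Open Scope classical_set_scope.
Local Open Scope ring_scope.

(* Subsets of [T] are the predicates [set T := T -> Prop].  Equality of sets
   is Leibniz equality, which is extensional by the axioms of [boolp]. *)

(** * Formal topologies *)

Record preord := Preord {
  pcar :> Type;
  ple : pcar -> pcar -> Prop;
  ple_refl : forall a, ple a a;
  ple_trans : forall a b c, ple a b -> ple b c -> ple a c }.

Arguments ple {p}.

Definition down2 (P : preord) (U V : set P) : set P :=
  [set c | exists a b, [/\ U a, V b, ple c a & ple c b]].

(* Every predicate being a [set], the requirement that [{a | a <| U}] be a set
   needs no clause. *)
Record is_cover (P : preord) (cov : P -> set P -> Prop) : Prop := IsCover {
  is_cover_refl : forall (U : set P) a, U a -> cov a U;
  is_cover_trans : forall a (U V : set P),
    cov a U -> (forall b, U b -> cov b V) -> cov a V;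
  is_cover_down : forall a (U V : set P),
    cov a U -> cov a V -> cov a (down2 U V);
  is_cover_le : forall a b, ple a b -> cov a [set b] }.

Record ftop := Ftop {
  ft_base :> preord;
  cov : ft_base -> set ft_base -> Prop;
  covP : is_cover cov }.

Arguments cov {f}.

Definition covs (S : ftop) (U V : set S) : Prop := forall a, U a -> cov a V.

Definition splitting (S : ftop) (V : set S) : Prop :=
  forall a (U : set S), V a -> cov a U -> V `&` U !=set0.

(** * Inductively generated formal topologies *)

(* [ax a C] says that [a <| C] is one of the generating axioms. *)
Inductive gen_cov (P : preord) (ax : P -> set P -> Prop) : P -> set P -> Prop :=
| gen_cov_refl (U : set P) a : U a -> gen_cov ax a U
| gen_cov_trans a (U V : set P) :
    gen_cov ax a U -> (forall b, U b -> gen_cov ax b V) -> gen_cov ax a V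
| gen_cov_down a (U V : set P) :
    gen_cov ax a U -> gen_cov ax a V -> gen_cov ax a (down2 U V)
| gen_cov_le a b : ple a b -> gen_cov ax a [set b]
| gen_cov_ax a (C : set P) : ax a C -> gen_cov ax a C.

Lemma gen_cov_is_cover (P : preord) (ax : P -> set P -> Prop) :
  is_cover (gen_cov ax).
Proof.
split; [exact: gen_cov_refl | exact: gen_cov_trans
       | exact: gen_cov_down | exact: gen_cov_le].
Qed.

Lemma gen_cov_least (P : preord) (ax c : P -> set P -> Prop) :
  is_cover c -> (forall a C, ax a C -> c a C) ->
  forall a U, gen_cov ax a U -> c a U.
Proof.
move=> cP axc a U; elim => {a U}.
- by move=> U a; exact: is_cover_refl.
- by move=> a U V _ aU _ UV; exact: is_cover_trans aU UV.
- by move=> a U V _ aU _ aV; exact: is_cover_down.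
- by move=> a b; exact: is_cover_le.
- exact: axc.
Qed.

Record igtop := Igtop {
  ig_base : preord;
  ig_ax : ig_base -> set ig_base -> Prop }.

Arguments ig_ax : clear implicits.

Definition ftop_of_igtop (S : igtop) : ftop :=
  Ftop (gen_cov_is_cover (ig_ax S)).

Coercion ftop_of_igtop : igtop >-> ftop.

(** * Formal topology maps *)

Definition rpre (S T : Type) (r : S -> T -> Prop) (D : set T) : set S :=
  [set a | exists2 b, D b & r a b].

Record is_ftmap (S T : ftop) (r : S -> T -> Prop) : Prop := IsFtmap {
  is_ftmap_total : covs [set: S] (rpre r [set: T]);
  is_ftmap_down : forall a b : T,
    covs (down2 (rpre r [set a]) (rpre r [set b]))
         (rpre r (down2 [set a] [set b]));
  is_ftmap_cov : forall (a : T) (U : set T),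
    cov a U -> covs (rpre r [set a]) (rpre r U) }.

Record ftmap (S T : ftop) := Ftmap {
  ftrel : S -> T -> Prop;
  ftrelP : is_ftmap ftrel }.

Definition ftmap_eq (S T : ftop) (r s : S -> T -> Prop) : Prop :=
  forall a : T, covs (rpre r [set a]) (rpre s [set a]) /\
                covs (rpre s [set a]) (rpre r [set a]).

Definition rcomp (S T W : Type) (r : S -> T -> Prop) (s : T -> W -> Prop) :
  S -> W -> Prop := fun a c => exists2 b, r a b & s b c.

Definition is_ftiso (S T : ftop) (r : S -> T -> Prop) : Prop :=
  is_ftmap r /\
  exists s : T -> S -> Prop,
    [/\ is_ftmap s, @ftmap_eq S S (rcomp r s) eq & @ftmap_eq T T (rcomp s r) eq].

(** * Subtopologies *)

Record subtop (S : ftop) := Subtop {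
  sub_cov : S -> set S -> Prop;
  sub_covP : is_cover sub_cov;
  sub_cov_incl : forall a U, cov a U -> sub_cov a U }.

Definition ftop_of_subtop (S : ftop) (T : subtop S) : ftop :=
  Ftop (sub_covP T).

Coercion ftop_of_subtop : subtop >-> ftop.

Definition subtop_eq (S : ftop) (T T' : subtop S) : Prop :=
  forall a U, sub_cov T a U <-> sub_cov T' a U.

Section Image.
Variables (S T : ftop) (r : ftmap S T).
Let R := ftrel r.

Definition image_cov (a : T) (U : set T) : Prop :=
  covs (rpre R [set a]) (rpre R U).

Lemma image_cov_incl a U : cov a U -> image_cov a U.
Proof. exact: (is_ftmap_cov (ftrelP r)). Qed.

Lemma image_cov_is_cover : is_cover image_cov.
Proof.
split.
- by move=> U a Ua x [b /= -> xa]; apply: (is_cover_refl (covP S)); exists a.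
- move=> a U V aU UV x xa; apply: (is_cover_trans (covP S) (aU x xa)).
  by move=> y [b Ub yb]; apply: (UV b Ub); exists b.
- move=> a U V aU aV x xa.
  apply: (is_cover_trans (covP S)
    (is_cover_down (covP S) (aU x xa) (aV x xa))) => c.
  move=> [u [v [[b Ub ub] [b' Vb' vb'] cu cv]]].
  have cd : down2 (rpre R [set b]) (rpre R [set b']) c.
    by exists u, v; split=> //; [exists b | exists b'].
  apply: (is_cover_trans (covP S) (is_ftmap_down (ftrelP r) cd)).
  move=> y [e [b1 [b2 [/= -> -> eb eb']]] ye].
  by apply: (is_cover_refl (covP S)); exists e => //; exists b, b'.
- by move=> a b ab; apply: image_cov_incl; exact: (is_cover_le (covP T)).
Qed.

Definition image_subtop : subtop T := Subtop image_cov_is_cover image_cov_incl.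

End Image.

Definition is_embedding (S T : ftop) (r : ftmap S T) : Prop :=
  @is_ftiso S (image_subtop r) (ftrel r).

Section OvertWeaklyClosed.
Variables (S : igtop) (V : set S).

Inductive owc_ax : ig_base S -> set (ig_base S) -> Prop :=
| owc_ax_base a C : ig_ax S a C -> owc_ax a C
| owc_ax_split a : owc_ax a (V `&` [set a]).

Lemma owc_cov_incl (a : S) (U : set S) : cov a U -> gen_cov owc_ax a U.
Proof.
apply: gen_cov_least => [|b C ax]; first exact: gen_cov_is_cover.
by apply: gen_cov_ax; exact: owc_ax_base.
Qed.

(* Meaningful when [V] is splitting. *)
Definition overt_weakly_closed : subtop S :=
  @Subtop S (gen_cov owc_ax) (gen_cov_is_cover owc_ax) owc_cov_incl.

End OvertWeaklyClosed.

(** * Products of inductively generated formal topologies *)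

Record fin (T : Type) := Fin {
  fin_set : set T;
  fin_enum : exists n (f : 'I_n -> T), fin_set = range f }.

Lemma fin_enum1 (T : Type) (x : T) :
  exists n (f : 'I_n -> T), [set x] = range f.
Proof.
exists 1%N, (fun _ => x); apply/seteqP; split=> [y -> | y [_ _ <-]] //.
by exists ord0.
Qed.

Lemma fin_enum2 (T : Type) (x y : T) :
  exists n (f : 'I_n -> T), [set x; y] = range f.
Proof.
exists 2%N, (fun i => if i == ord0 then x else y).
apply/seteqP; split=> z.
- by case=> ->; [exists ord0 | exists ord_max].
- by case=> i _ <-; case: ifP => _; [left | right].
Qed.

Definition fin1 (T : Type) (x : T) : fin T := Fin (fin_enum1 x).
Definition fin2 (T : Type) (x y : T) : fin T := Fin (fin_enum2 x y).

Section Product.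
Variables (I : Type) (S : I -> igtop).

Definition prod_pt := {i : I & ig_base (S i)}.
Definition ppt (i : I) (a : ig_base (S i)) : prod_pt :=
  existT (fun i => pcar (ig_base (S i))) i a.

Definition prod_le (A B : fin prod_pt) : Prop :=
  forall i (b : ig_base (S i)), fin_set B (ppt b) ->
  exists2 a : ig_base (S i), fin_set A (ppt a) & ple a b.

Lemma prod_le_refl A : prod_le A A.
Proof. by move=> i b Ab; exists b => //; exact: ple_refl. Qed.

Lemma prod_le_trans A B C : prod_le A B -> prod_le B C -> prod_le A C.
Proof.
move=> AB BC i c /BC[b /AB[a Aa ab] bc].
by exists a => //; exact: ple_trans ab bc.
Qed.

Definition prod_base := Preord prod_le_refl prod_le_trans.

Inductive prod_ax : prod_base -> set prod_base -> Prop :=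
| prod_ax_total (A : prod_base) i :
    prod_ax A [set fin1 (ppt a) | a in [set: ig_base (S i)]]
| prod_ax_down i (a b : ig_base (S i)) :
    prod_ax (fin2 (ppt a) (ppt b))
      [set fin1 (ppt c) | c in [set c | ple c a /\ ple c b]]
| prod_ax_base i (a : ig_base (S i)) (C : set (ig_base (S i))) :
    ig_ax (S i) a C -> prod_ax (fin1 (ppt a)) [set fin1 (ppt b) | b in C].

Definition ig_prod : igtop := Igtop prod_ax.

End Product.

(** * Upper reals *)

Record ureal := UReal {
  cut : set rat;
  cut_pos : forall q, cut q -> 0 < q;
  cut_round : forall q, cut q <-> exists2 q', q' < q & cut q' }.

Lemma ureal_eq (U V : ureal) : (forall q, cut U q <-> cut V q) -> U = V.
Proof.
case: U V => [U Up Ur] [V Vp Vr] /= /predeqP UV; case: _ / UV in Vp Vr *.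
by congr UReal; exact: Prop_irrelevance.
Qed.

Lemma cut_up (U : ureal) q q' : cut U q -> q <= q' -> cut U q'.
Proof.
move=> Uq; rewrite le_eqVlt => /orP[/eqP <- //|qq'].
by apply/cut_round; exists q.
Qed.

Definition ule (U V : ureal) : Prop := cut V `<=` cut U.

Section UrealOps.
Variables U V : ureal.

Definition uadd_cut : set rat :=
  [set q | exists q1 q2, [/\ cut U q1, cut V q2 & q = q1 + q2]].

Lemma uadd_pos q : uadd_cut q -> 0 < q.
Proof.
by move=> [q1 [q2 [/cut_pos ? /cut_pos ? ->]]]; exact: addr_gt0.
Qed.

Lemma uadd_round q : uadd_cut q <-> exists2 q', q' < q & uadd_cut q'.
Proof.
split=> [[q1 [q2 [/cut_round[q1' lt Uq] Vq ->]]]|[q' lt [q1 [q2 [Uq Vq E]]]]].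
- by exists (q1' + q2); [rewrite ltrD2r | exists q1', q2].
- exists q1, (q - q1); split=> //; last by ring.
  by apply: cut_up Vq _; rewrite E in lt; lra.
Qed.

Definition uadd : ureal := UReal uadd_pos uadd_round.

(* As [ule] is reverse inclusion, the supremum is the intersection. *)
Definition usup_cut : set rat := cut U `&` cut V.

Lemma usup_pos q : usup_cut q -> 0 < q.
Proof. by case=> /cut_pos. Qed.

Lemma usup_round q : usup_cut q <-> exists2 q', q' < q & usup_cut q'.
Proof.
split=> [[/cut_round[q1 lt1 U1] /cut_round[q2 lt2 V2]]|[q' lt [Uq Vq]]].
- exists (Num.max q1 q2); first by rewrite gt_max lt1 lt2.
  by split; [apply: cut_up U1 _ | apply: cut_up V2 _]; rewrite le_max lexx ?orbT.
- by split; [apply: cut_up Uq _ | apply: cut_up Vq _]; exact: ltW.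
Qed.

Definition usup : ureal := UReal usup_pos usup_round.

End UrealOps.

Section UrealOfRat.
Variable r : rat.

Definition urat_cut : set rat := [set q | 0 < q /\ r < q].

Lemma urat_pos q : urat_cut q -> 0 < q.
Proof. by case. Qed.

Lemma urat_round q : urat_cut q <-> exists2 q', q' < q & urat_cut q'.
Proof.
split=> [[q0 rq]|[q' lt [q0 rq]]]; last by split; lra.
have [r0|r0] := leP 0 r.
- by exists ((r + q) / 2%:R); [lra | split; lra].
- by exists (q / 2%:R); [lra | split; lra].
Qed.

(* The identification of a rational with an upper real, for [0 <= r]. *)
Definition urat : ureal := UReal urat_pos urat_round.

End UrealOfRat.

Definition ult (U V : ureal) : Prop :=
  exists2 r : rat, 0 < r & ule (uadd U (urat r)) V.

(** * Generalised uniform spaces *)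

Record gmetric (X : Type) := GMetric {
  gdist :> X -> X -> ureal;
  gdist_refl : forall x, gdist x x = urat 0;
  gdist_tri : forall x y z, ule (gdist x z) (uadd (gdist x y) (gdist y z)) }.

Definition gle (X : Type) (d e : gmetric X) : Prop :=
  forall x y, ule (d x y) (e x y).

Definition gsymmetric (X : Type) (d : gmetric X) : Prop :=
  forall x y, d x y = d y x.

Lemma gmetric_eq (X : Type) (d e : gmetric X) :
  (forall x y, d x y = e x y) -> d = e.
Proof.
case: d e => [d d0 dt] [e e0 et] /= de.
have E : d = e by apply: funext => x; apply: funext => y.
by case: _ / E in e0 et de *; congr GMetric; exact: Prop_irrelevance.
Qed.

Section Gsup.
Variables (X : Type) (d e : gmetric X).

Let gsup_dist (x y : X) : ureal := usup (d x y) (e x y).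

Lemma gsup_refl x : gsup_dist x x = urat 0.
Proof.
apply: ureal_eq => q; rewrite /gsup_dist /= /usup_cut !gdist_refl.
by split=> [[]|].
Qed.

Lemma gsup_tri x y z :
  ule (gsup_dist x z) (uadd (gsup_dist x y) (gsup_dist y z)).
Proof.
move=> q [q1 [q2 [[d1 e1] [d2 e2] ->]]].
by split; apply: (@gdist_tri _ _ x y z); exists q1, q2; split.
Qed.

Definition gsup : gmetric X := GMetric gsup_refl gsup_tri.

End Gsup.

Lemma gsupP (X : Type) (d e c : gmetric X) :
  gle (gsup d e) c <-> gle d c /\ gle e c.
Proof.
split=> [H|[H1 H2] x y q cq]; last by split; [exact: H1 | exact: H2].
by split=> x y q /H[].
Qed.

Record gus := Gus {
  gus_pt :> Type;
  gus_met : set (gmetric gus_pt);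
  gus_inhabited : gus_met !=set0;
  gus_sup : forall d e, gus_met d -> gus_met e -> gus_met (gsup d e) }.

Arguments gus_met : clear implicits.

Definition gus_symmetric (X : gus) : Prop :=
  forall d, gus_met X d -> gsymmetric d.

Section SingleMetric.
Variables (X : Type) (d : gmetric X).

Lemma single_inhabited : [set d] !=set0.
Proof. by exists d. Qed.

Lemma single_sup e c : [set d] e -> [set d] c -> [set d] (gsup e c).
Proof.
move=> /= -> ->; apply: gmetric_eq => x y; apply: ureal_eq => q.
by split=> [[]|].
Qed.

Definition gus_single : gus := Gus single_inhabited single_sup.

End SingleMetric.

(** * Localic completion *)

Definition Qpos := {q : rat | 0 < q}.

Section LocalicCompletion.
Variable X : gus.

Definition met := {d : gmetric X | gus_met X d}.

Record fball := FBall { fb_met : met; fb_ctr : X; fb_rad : Qpos }.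

Definition fb_le (b a : fball) : Prop :=
  gle (sval (fb_met a)) (sval (fb_met b)) /\
  ule (uadd (sval (fb_met a) (fb_ctr a) (fb_ctr b)) (urat (sval (fb_rad b))))
      (urat (sval (fb_rad a))).

Definition fb_lt (b a : fball) : Prop :=
  gle (sval (fb_met a)) (sval (fb_met b)) /\
  ult (uadd (sval (fb_met a) (fb_ctr a) (fb_ctr b)) (urat (sval (fb_rad b))))
      (urat (sval (fb_rad a))).

Lemma fb_le_refl a : fb_le a a.
Proof.
split=> [x y q //|q]; case: a => [d x [e e0]] /= [q0 eq]; rewrite gdist_refl.
exists ((q - e) / 2%:R), (e + (q - e) / 2%:R).
by split; [split; lra | split; lra | lra].
Qed.

Lemma fb_le_trans a b c : fb_le a b -> fb_le b c -> fb_le a c.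
Proof.
case: a b c => [d w [g g0]] [r v [e e0]] [s u [k k0]] [/= rd ab] [/= sr bc].
split=> /= [x y q H|q /bc]; first exact/sr/rd.
move=> [q1 [q2 [s1 /ab[q3 [q4 [r3 g4 ->]]] ->]]].
exists (q1 + q3), q4; split=> //; last by rewrite addrA.
by apply: (@gdist_tri _ _ u v w); exists q1, q3; split=> //; exact: sr.
Qed.

Definition fb_preord := Preord fb_le_refl fb_le_trans.

Inductive lc_ax : fb_preord -> set fb_preord -> Prop :=
| lc_ax_U1 (a : fb_preord) : lc_ax a [set b | fb_lt b a]
| lc_ax_U2 (a : fb_preord) (d : met) (e : Qpos) :
    lc_ax a [set FBall d x e | x in [set: X]].

Definition localic_completion : igtop := Igtop lc_ax.

End LocalicCompletion.

Definition metric_completion (X : Type) (d : gmetric X) : igtop :=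
  localic_completion (gus_single d).

Definition prod_completion (X : gus) : igtop :=
  ig_prod (fun d : met X => metric_completion (sval d)).

(* Main.v *)
(* A ball of U(X) is related to a finite set A of balls of the factors when it
   lies below every member of A, each read as a ball of U(X).  Taking for A the
   ball itself, in the factor of its own metric, shows that this map is an
   embedding.  The splitting subset consists of the A lying above some ball.
   To see that the image cover is the overt weakly closed one, send a back to
   the singleton {a}: by induction on covers, a <| U in U(X) implies
   {a} <| {{u} | u in U} in the subtopology.  Positivity provides the common
   point which makes the triangle inequality, hence symmetry, applicable to
   balls of different metrics. *)

Require Import Defs.
From mathcomp Require Import all_boot classical_sets.
From mathcomp Require Import all_order all_algebra boolp lra.

Set Implicit Arguments.
Unset Strict Implicit.
Unset Printing Implicit Defensive.

Import Order.TTheory GRing.Theory Num.Theory.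

Local Open Scope classical_set_scope.
Local Open Scope ring_scope.

(** * Covers, maps and embeddings in general *)

Section Covers.
Variables (P : preord) (c : P -> set P -> Prop) (cP : is_cover c).

Lemma cover_le_trans a b (U : set P) : ple a b -> c b U -> c a U.
Proof.
by move=> ab bU; apply: (is_cover_trans cP (is_cover_le cP ab)) => _ ->.
Qed.

Lemma cover_sub a (U W : set P) : c a U -> U `<=` W -> c a W.
Proof.
move=> aU UW; apply: (is_cover_trans cP aU) => b /UW.
exact: is_cover_refl.
Qed.

Lemma cover_le_sub a b (U : set P) : ple a b -> U b -> c a U.
Proof. by move=> ab Ub; apply: cover_le_trans ab _; exact: is_cover_refl. Qed.

Lemma cover_downset a (U : set P) :
  c a U -> c a [set b | ple b a /\ exists2 u, U u & ple b u].
Proof.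
move=> aU; apply: (cover_sub (is_cover_down cP _ aU) _).
  by apply: (is_cover_refl cP (U := [set a])).
by move=> b [_ [u [/= -> Uu ba bu]]]; split=> //; exists u.
Qed.

End Covers.

(** The pairs [(a, U)] with [r^-a <| r^-U] form a cover: the meet condition on [r] gives closure
    under [down2], monotonicity gives the order rule. Leastness of the generated cover then leaves
    only the axioms. *)
Lemma gen_is_ftmap (S : ftop) (T : igtop) (r : S -> T -> Prop) :
  covs [set: S] (rpre r [set: T]) ->
  (forall a b : T, covs (down2 (rpre r [set a]) (rpre r [set b]))
                        (rpre r (down2 [set a] [set b]))) ->
  (forall a b x, ple a b -> r x a -> r x b) ->
  (forall a C, ig_ax T a C -> covs (rpre r [set a]) (rpre r C)) ->
  is_ftmap r.
Proof.
move=> rT rD rle rax; split=> // a U.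
apply: (@gen_cov_least _ _ (fun a U => covs (rpre r [set a]) (rpre r U)))
  => // {a U}; split.
- by move=> U a Ua x [_ /= -> xa]; apply: (is_cover_refl (covP S)); exists a.
- move=> a U V aU UV x xa; apply: (is_cover_trans (covP S) (aU x xa)).
  by move=> y [b Ub yb]; apply: (UV b Ub); exists b.
- move=> a U V aU aV x xa.
  apply: (is_cover_trans (covP S)
    (is_cover_down (covP S) (aU x xa) (aV x xa))) => y.
  move=> [u [v [[b Ub ub] [b' Vb' vb'] yu yv]]].
  apply: (cover_sub (covP S) (rD b b' y _)).
    by exists u, v; split=> //; [exists b | exists b'].
  by move=> z [e [_ [_ [/= -> -> eb eb']]] ze]; exists e => //; exists b, b'.
- move=> a b ab x [_ /= -> xa]; apply: (is_cover_refl (covP S)).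
  by exists b => //; exact: rle xa.
Qed.

Lemma rpre_eq (T : Type) (U : set T) : rpre eq U = U.
Proof. by apply/seteqP; split=> [x [y Uy ->]|x Ux] //; exists x. Qed.

(* The inverse relates [b] to [a] when [r^-b <| a]. *)
Lemma embedding_of_local_base (S T : ftop) (r : ftmap S T) :
  (forall a : S,
     cov a (rpre (ftrel r) [set b | covs (rpre (ftrel r) [set b]) [set a]])) ->
  is_embedding r.
Proof.
case: r => r rP /= H; set s := fun b a => covs (rpre r [set b]) [set a].
(* By hypothesis each [u] in [U] is covered by [r^- s^- u], so a cover by [U] can be traded for one
   by [r^- s^- U]. Covers in the image unfold to covers in [S], and each condition on [s] reduces to
   this trade. *)
have tr x (U : set S) : cov x U -> cov x (rpre r (rpre s U)).
  move=> xU; apply: (is_cover_trans (covP S) xU) => u Uu.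
  apply: (cover_sub (covP S) (H u)) => y [b bu yb].
  by exists b => //; exists u.
split; first by have [rT rD _] := rP; split.
exists s; split.
- split.
  + by move=> b _ /= x _; apply: tr; exact: (is_cover_refl (covP S)).
  + move=> a b C [A [B [[_ /= -> Aa] [_ /= -> Bb] CA CB]]] /= x xC.
    apply: tr; apply: (is_cover_down (covP S)).
    * have := is_ftmap_cov rP (is_cover_le (covP T) CA) xC.
      by move/(is_cover_trans (covP S)); apply; exact: Aa.
    * have := is_ftmap_cov rP (is_cover_le (covP T) CB) xC.
      by move/(is_cover_trans (covP S)); apply; exact: Bb.
  + move=> a U aU A [_ /= -> Aa] /= x xA; apply: tr.
    by apply: (is_cover_trans (covP S) (Aa x xA)) => _ ->.
- move=> a; rewrite rpre_eq; split=> [x [_ /= -> [A xA Aa]]|_ ->].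
    by apply: Aa; exists A.
  apply: (cover_sub (covP S) (H a)) => y [A Aa yA].
  by exists a => //; exists A.
- move=> B; rewrite rpre_eq;
  split=> [A [_ /= -> [a Aa aB]] /= x xA|_ -> /= x [_ /= -> xB]].
    apply: (is_cover_trans (covP S) (Aa x xA)) => _ ->.
    by apply: (is_cover_refl (covP S)); exists B.
  apply: (cover_sub (covP S) (H x)) => y [A Ax yA].
  by exists A => //; exists B => //; exists x.
Qed.

(** * Finite sets and the product order *)

Lemma fin_enumU (T : Type) (A B : fin T) :
  exists n (f : 'I_n -> T), fin_set A `|` fin_set B = range f.
Proof.
have [n [f ->]] := fin_enum A; have [m [g ->]] := fin_enum B.
exists (n + m)%N, (fun i => match split i with inl j => f j | inr k => g k end).
apply/seteqP; split=> x.
  case=> -[i _ <-].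
    by exists (lshift m i) => //; rewrite (unsplitK (inl i)).
  by exists (rshift n i) => //; rewrite (unsplitK (inr i)).
by case=> i _ <-; case: (split i) => j; [left | right]; exists j.
Qed.

Definition finU (T : Type) (A B : fin T) : fin T := Fin (fin_enumU A B).

Lemma fin_enum0 (T : Type) : exists n (f : 'I_n -> T), set0 = range f.
Proof.
have f : 'I_0 -> T by case.
by exists 0%N, f; apply/seteqP; split=> x // [[]].
Qed.

Definition fin0 (T : Type) : fin T := Fin (fin_enum0 T).

Lemma fin_ind (T : Type) (Q : set T -> Prop) :
  Q set0 -> (forall x B, Q B -> Q ([set x] `|` B)) ->
  forall A : fin T, Q (fin_set A).
Proof.
move=> Q0 QU A; have [n [f ->]] := fin_enum A; elim: n f {A} => [|n IH] f.
  suff -> : range f = set0 by [].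
  by apply/seteqP; split=> x // [[]].
suff -> : range f = [set f ord0] `|` range (f \o lift ord0).
  exact/QU/IH.
apply/seteqP; split=> x.
  case=> i _ <-; case: (unliftP ord0 i) => [j|] ->; last by left.
  by right; exists j.
by case=> [->|[j _ <-]]; [exists ord0 | exists (lift ord0 j)].
Qed.

Section ProdLe.
Variables (I : Type) (S : I -> igtop).

Lemma prod_leP (A B : prod_base S) :
  (forall p, fin_set B p -> exists2 a, fin_set A (ppt a) & ple a (tagged p)) ->
  ple A B.
Proof. by move=> H i b /H. Qed.

Lemma prod_le_subset (A B : prod_base S) :
  fin_set B `<=` fin_set A -> ple A B.
Proof. by move=> BA i b /BA Ab; exists b => //; exact: ple_refl. Qed.

Lemma prod_le_fin1 i (a b : ig_base (S i)) :
  ple a b -> ple (fin1 (ppt a) : prod_base S) (fin1 (ppt b)).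
Proof. by move=> ab; apply: prod_leP => _ /= ->; exists a. Qed.

Lemma prod_le_fin2 (D : prod_base S) i (a b : ig_base (S i)) :
  ple D (fin1 (ppt a)) -> ple D (fin1 (ppt b)) ->
  ple D (fin2 (ppt a) (ppt b)).
Proof.
by move=> Da Db; apply: prod_leP => _ /= [] ->; [exact: Da | exact: Db].
Qed.

End ProdLe.

(** * Sums of upper reals in terms of cuts *)

Lemma ule_uadd_urat (U : ureal) (r s : rat) : 0 < r -> 0 < s ->
  ule (uadd U (urat r)) (urat s) <-> (forall q, s < q + r -> cut U q).
Proof.
move=> r0 s0; split=> [H q sq|H t [t0 st]].
  have [|q1 [q2 [Uq1 [_ rq2] E]]] := H (q + r); first by split; lra.
  by apply: cut_up Uq1 _; lra.
(* Roundness keeps the second summand [t - q'] strictly above [r]. *)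
have /cut_round[q' lt Uq'] : cut U (t - r) by apply: H; lra.
by exists q', (t - q'); split=> //; [split; lra | lra].
Qed.

Lemma ult_uadd_urat (U : ureal) (r s : rat) : 0 < r -> 0 < s ->
  ult (uadd U (urat r)) (urat s) <-> cut U (s - r).
Proof.
move=> r0 s0; split=> [[k k0 H]|/cut_round[q' lt Uq']].
  have [|q1 [q2 [[q3 [q4 [Uq3 [_ rq4] ->]]] [_ kq2] E]]] := H (s + k).
    by split; lra.
  by apply: cut_up Uq3 _; lra.
(* The gap between [q'] and [s - r] is the positive rational that [ult] asks for; below, half of
   [t - s] goes to each of the two strict bounds. *)
exists (s - r - q'); first lra.
move=> t [t0 st].
exists (q' + (r + (t - s) / 2%:R)), (s - r - q' + (t - s) / 2%:R).
split; [|split; lra|lra].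
by exists q', (r + (t - s) / 2%:R); split=> //; split; lra.
Qed.

Lemma gle_refl (X : Type) (d : gmetric X) : gle d d.
Proof. by move=> x y q. Qed.

Definition qpos (q : rat) (q0 : 0 < q) : Qpos := exist _ q q0.

Lemma Qpos_gt0 (e : Qpos) : 0 < sval e.
Proof. by case: e. Qed.

(** * Balls of a generalised uniform space and their points *)

Section Balls.
Variable X : gus.
Implicit Types (a b u v : fball X) (x y z : X).

Lemma fb_leE b a : fb_le b a <->
  gle (sval (fb_met a)) (sval (fb_met b)) /\
  (forall q, sval (fb_rad a) < q + sval (fb_rad b) ->
     cut (sval (fb_met a) (fb_ctr a) (fb_ctr b)) q).
Proof.
by rewrite /fb_le; split=> -[? /(ule_uadd_urat _ (Qpos_gt0 _) (Qpos_gt0 _)) ?].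
Qed.

Lemma fb_ltE b a : fb_lt b a <->
  gle (sval (fb_met a)) (sval (fb_met b)) /\
  cut (sval (fb_met a) (fb_ctr a) (fb_ctr b))
      (sval (fb_rad a) - sval (fb_rad b)).
Proof.
by rewrite /fb_lt; split=> -[? /(ult_uadd_urat _ (Qpos_gt0 _) (Qpos_gt0 _)) ?].
Qed.

Lemma cut_tri (d : gmetric X) x y z p q :
  cut (d x y) p -> cut (d y z) q -> cut (d x z) (p + q).
Proof. by move=> dp dq; apply: (@gdist_tri _ d x y z); exists p, q. Qed.

Lemma cut_dist0 (d : gmetric X) x q : 0 < q -> cut (d x x) q.
Proof. by rewrite gdist_refl. Qed.

Lemma fb_ltW b a : fb_lt b a -> fb_le b a.
Proof.
move=> /fb_ltE[ab H]; apply/fb_leE; split=> // q lt.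
by apply: cut_up H _; lra.
Qed.

Lemma fb_lt_le_trans b a c : fb_lt b a -> fb_le a c -> fb_lt b c.
Proof.
move=> /fb_ltE[ab /cut_round[q lt H]] /fb_leE[ca H']; apply/fb_ltE; split.
  by move=> x y t /ab /ca.
apply: (@cut_up _ ((sval (fb_rad c) - sval (fb_rad b) - q) + q)); last lra.
by apply: (cut_tri (H' _ _) (ca _ _ _ H)); lra.
Qed.

(** When [d] is coarser than the metric of [b], this is a larger ball. It carries [b] into the
    factor of [d], as the product order only compares balls within one factor. *)
Definition fb_rebase b (d : met X) : fball X := FBall d (fb_ctr b) (fb_rad b).

Lemma fb_le_rebase b (d : met X) :
  gle (sval d) (sval (fb_met b)) -> fb_le b (fb_rebase b d).
Proof.
by move=> db; apply/fb_leE; split=> //= q lt; apply: cut_dist0; lra.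
Qed.

Lemma fb_rebase_le b a : fb_le b a -> fb_le (fb_rebase b (fb_met a)) a.
Proof. by move=> [_ ba]; split=> //; exact: gle_refl. Qed.

Lemma fb_rebase_lt b a : fb_lt b a -> fb_lt (fb_rebase b (fb_met a)) a.
Proof. by move=> [_ ba]; split=> //; exact: gle_refl. Qed.

Definition fb_mem x a : Prop :=
  cut (sval (fb_met a) (fb_ctr a) x) (sval (fb_rad a)).

Lemma fb_mem_ctr a : fb_mem (fb_ctr a) a.
Proof. exact/cut_dist0/Qpos_gt0. Qed.

Lemma fb_le_mem b a : fb_le b a -> fb_mem (fb_ctr b) a.
Proof. by move=> /fb_leE[_]; apply; rewrite ltrDl; exact: Qpos_gt0. Qed.

Lemma fb_mem_le x b a : fb_le b a -> fb_mem x b -> fb_mem x a.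
Proof.
move=> /fb_leE[ab H] /cut_round[q lt /ab xq].
apply: (@cut_up _ ((sval (fb_rad a) - q) + q)); last lra.
by apply: cut_tri xq; apply: H; lra.
Qed.

Lemma fb_mem_lt x a (d : met X) :
  gle (sval (fb_met a)) (sval d) -> fb_mem x a ->
  exists2 e : rat, 0 < e &
    forall k : Qpos, sval k <= e -> fb_lt (FBall d x k) a.
Proof.
move=> ad /cut_round[q lt xq].
exists (sval (fb_rad a) - q); first lra.
by move=> k ke; apply/fb_ltE; split=> //=; apply: cut_up xq _; lra.
Qed.

Definition met_sup (d e : met X) : met X :=
  exist (gus_met X) (gsup (sval d) (sval e)) (gus_sup (svalP d) (svalP e)).

Lemma fb_mem_down x a b : fb_mem x a -> fb_mem x b ->
  exists c, [/\ fb_mem x c, fb_lt c a & fb_lt c b].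
Proof.
(* The supremum of the two metrics is finer than both, so its small balls can lie below [a] and [b]
   at once; the radius is the smaller of the two margins. *)
move=> xa xb; pose d := met_sup (fb_met a) (fb_met b).
have [ad bd] : gle (sval (fb_met a)) (sval d) /\ gle (sval (fb_met b)) (sval d).
  by apply/gsupP; exact: gle_refl.
have [e e0 He] := fb_mem_lt ad xa; have [k k0 Hk] := fb_mem_lt bd xb.
have m0 : 0 < Num.min e k by rewrite lt_min e0 k0.
exists (FBall d x (qpos m0)).
split; first exact: (fb_mem_ctr (FBall _ x _)).
- by apply: He; rewrite ge_min lexx.
- by apply: Hk; rewrite ge_min lexx orbT.
Qed.

(* Every point of [X] defines a formal point. *)
Lemma lc_cov_mem (a : localic_completion X) U x :
  cov a U -> fb_mem x a -> exists2 b, U b & fb_mem x b.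
Proof.
apply: (@gen_cov_least (fb_preord X) (@lc_ax X)
  (fun a U => fb_mem x a -> exists2 b, U b & fb_mem x b)) => {a U}.
  split.
  - by move=> U a Ua xa; exists a.
  - by move=> a U V aU UV /aU[b /UV].
  - move=> a U V aU aV xa; have [[u Uu xu] [v Vv xv]] := (aU xa, aV xa).
    have [c [xc cu cv]] := fb_mem_down xu xv.
    by exists c => //; exists u, v; split=> //; exact: fb_ltW.
  - by move=> a b ab xa; exists b => //; exact: fb_mem_le xa.
move=> _ _ [a xa|a d e _].
  by have [c [xc ca _]] := fb_mem_down xa xa; exists c.
by exists (FBall d x e); [exists x | exact: (fb_mem_ctr (FBall d x e))].
Qed.

Lemma lc_cov_inhabited (a : localic_completion X) U : cov a U -> U !=set0.
Proof. by move=> /lc_cov_mem /(_ (fb_mem_ctr a))[b Ub _]; exists b. Qed.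

End Balls.

(** * The embedding into the product *)

Section Embedding.
Variable X : gus.

Let S := localic_completion X.
Let PC := prod_completion X.
Let factor (d : met X) := metric_completion (sval d).
Let pt := prod_pt factor.

Definition global_ball (d : met X) (b : ig_base (factor d)) : fball X :=
  @FBall X d (fb_ctr b) (fb_rad b).

Definition local_ball (a : fball X) : ig_base (factor (fb_met a)) :=
  @FBall (gus_single (sval (fb_met a)))
    (exist [set sval (fb_met a)] (sval (fb_met a)) erefl)
    (fb_ctr a) (fb_rad a).

Definition single (a : fball X) : prod_base factor := fin1 (ppt (local_ball a)).

Lemma global_localK a : global_ball (local_ball a) = a.
Proof. by case: a. Qed.

(** The metric stored in [b] is only provably equal to [sval d]; after substitution, proof
    irrelevance identifies the membership proofs. *)
Lemma local_globalK d (b : ig_base (factor d)) : local_ball (global_ball b) = b.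
Proof.
case: b => -[m mE] x e; have E : m = sval d by [].
by subst m; rewrite /local_ball (Prop_irrelevance mE erefl).
Qed.

Lemma factor_metE d (b : ig_base (factor d)) : sval (fb_met b) = sval d.
Proof. exact: (svalP (fb_met b)). Qed.

Lemma global_le d (b a : ig_base (factor d)) :
  fb_le (global_ball b) (global_ball a) <-> ple b a.
Proof. by rewrite /= /fb_le !factor_metE. Qed.

Lemma global_lt d (b a : ig_base (factor d)) :
  fb_lt (global_ball b) (global_ball a) <-> fb_lt b a.
Proof. by rewrite /fb_lt !factor_metE. Qed.

Definition in_all_balls (a : S) (A : PC) : Prop :=
  forall p, fin_set A p -> fb_le a (global_ball (tagged p)).

Lemma in_all_balls_le A B a : ple A B -> in_all_balls a A -> in_all_balls a B.
Proof.
move=> AB aA [i b] /AB[c Ac cb].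
by apply: fb_le_trans (aA _ Ac) _; exact/global_le.
Qed.

Lemma in_all_balls_fin1 a d (b : ig_base (factor d)) :
  in_all_balls a (fin1 (ppt b)) <-> fb_le a (global_ball b).
Proof. by split=> [H|H _ ->]; [exact: (H _ erefl) | exact: H]. Qed.

Lemma in_all_balls_ftmap : is_ftmap in_all_balls.
Proof.
have cP := covP S.
apply: gen_is_ftmap => [a _|A B c|A B x|_ _ [A d|d a b|d a C aC]].
(* The empty finite set is the top element: every ball is vacuously related to it. *)
- by apply: (is_cover_refl cP); exists (fin0 pt).
- move=> [a [b [[_ /= -> aA] [_ /= -> bB] ca cb]]]; apply: (is_cover_refl cP).
  (* The union is the meet of [A] and [B] in the product order. *)
  exists (finU A B).
    by exists A, B; split=> //; apply: prod_le_subset => p; [left | right].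
  by move=> p [/aA|/bB]; exact: fb_le_trans.
- exact: in_all_balls_le.
- move=> x _.
  apply: (cover_sub cP (gen_cov_ax (lc_ax_U2 x d (qpos ltr01)))).
  move=> _ [y _ <-]; set b := FBall _ _ _.
  exists (single b); first by exists (local_ball b).
  by apply/in_all_balls_fin1; rewrite global_localK; exact: fb_le_refl.
- move=> x [_ /= -> xab]; apply: (is_cover_refl cP).
  have xa := xab _ (or_introl erefl); have xb := xab _ (or_intror erefl).
  (* The metric of [x] may be finer than [d]; read in [d], the ball enters the factor, lies above
     [x] and stays below both [a] and [b]. *)
  pose c := fb_rebase x d.
  exists (single c).
    by exists (local_ball c) => //; split; apply/global_le;
      [exact: (fb_rebase_le xa) | exact: (fb_rebase_le xb)].
  apply/in_all_balls_fin1; rewrite global_localK; apply: fb_le_rebase.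
  by case: xa.
- move=> x [_ /= -> /in_all_balls_fin1 xa]; case: aC xa => {a C} [a|a e k] xa.
    apply: (cover_sub cP (gen_cov_ax (lc_ax_U1 x))) => y yx.
    have ya := fb_lt_le_trans yx xa; pose c := fb_rebase y d.
    exists (single c).
      by exists (local_ball c) => //; apply/global_lt;
        exact: (fb_rebase_lt ya).
    apply/in_all_balls_fin1; rewrite global_localK; apply: fb_le_rebase.
    by case: ya.
  apply: (cover_sub cP (gen_cov_ax (lc_ax_U2 x d k))) => _ [y _ <-].
  exists (fin1 (@ppt _ factor d (@FBall (gus_single (sval d)) e y k))).
    by exists (@FBall (gus_single (sval d)) e y k) => //; exists y.
  by apply/in_all_balls_fin1; exact: fb_le_refl.
Qed.

Definition completion_map : ftmap S PC := Ftmap in_all_balls_ftmap.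

Lemma completion_map_embedding : is_embedding completion_map.
Proof.
apply: embedding_of_local_base => a; apply: (is_cover_refl (covP S)).
exists (single a).
  move=> x [_ /= -> /in_all_balls_fin1]; rewrite global_localK.
  exact: (is_cover_le (covP S)).
by apply/in_all_balls_fin1; rewrite global_localK; exact: fb_le_refl.
Qed.

Definition positive : set PC := [set A | exists a, in_all_balls a A].

(** The cover pulls back along the map to a cover of the ball [a]. As [a] contains its centre, the
    pulled-back cover is inhabited, and any ball in it makes some [B] in [U] positive. *)
Lemma positive_splitting : splitting positive.
Proof.
move=> A U [a aA] /(is_ftmap_cov in_all_balls_ftmap) /(_ a).
case/(_ _)/lc_cov_inhabited; first by exists A.
by move=> b [B UB bB]; exists B; split=> //; exists b.
Qed.

(** * The image as the overt weakly closed subtopology *)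

Let W := overt_weakly_closed positive.
Let WP : is_cover (sub_cov W) := sub_covP W.

(** A ball related to [A] is itself evidence that [A] is positive, so the added axiom holds in the
    image. *)
Lemma owc_image A U : sub_cov W A U -> image_cov completion_map A U.
Proof.
apply: (@gen_cov_least _ _ (image_cov completion_map)).
  exact: image_cov_is_cover.
move=> {A U} _ _ [A C ax|A].
  by apply: image_cov_incl; exact: gen_cov_ax.
move=> a [_ /= -> aA]; apply: (is_cover_refl (covP S)).
by exists A => //; split=> //; exists a.
Qed.

(** Any member of [positive] meet [{A}] proves [A] positive; thus the added axiom allows positivity
    to be assumed without being decided. *)
Lemma owc_split (A : PC) U :
  (positive A -> sub_cov W A U) -> sub_cov W A U.
Proof.
move=> H; apply: (is_cover_trans WP (gen_cov_ax (owc_ax_split _ A))).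
by move=> B [+ BA]; rewrite BA; exact: H.
Qed.

Lemma owc_ax_cov (A : PC) C : prod_ax A C -> sub_cov W A C.
Proof. by move=> ax; apply: gen_cov_ax; exact: owc_ax_base. Qed.

Lemma owc_factor_cov d (a : ig_base (factor d)) C :
  ig_ax (factor d) a C ->
  sub_cov W (fin1 (ppt a) : PC) [set fin1 (ppt b) | b in C].
Proof. by move=> ax; apply: owc_ax_cov; exact: prod_ax_base. Qed.

Lemma owc_shrink (a : fball X) :
  sub_cov W (single a)
    [set single b | b in [set b | fb_met b = fb_met a /\ fb_lt b a]].
Proof.
apply: (cover_sub WP (owc_factor_cov (lc_ax_U1 (local_ball a)))).
move=> _ [b /= /global_lt ba <-]; rewrite global_localK in ba.
by exists (global_ball b) => //; rewrite /single local_globalK.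
Qed.

(** The totality axiom of the product at index [d] leads from [A] into that factor, where U2
    applies. *)
Lemma owc_small (A : PC) (d : met X) (e : Qpos) :
  sub_cov W A [set single (FBall d x e) | x in [set: X]].
Proof.
apply: (is_cover_trans WP (owc_ax_cov (prod_ax_total A d))) => _ [a _ <-].
pose d' : met (gus_single (sval d)) := exist [set sval d] (sval d) erefl.
apply: (cover_sub WP (owc_factor_cov (lc_ax_U2 a d' e))).
by move=> _ [_ [x _ <-] <-]; exists x.
Qed.

Hypothesis hX : gus_symmetric X.

(* A positive element below both a ball with margin [k] inside [u] and a
   [d]-ball of radius [k / 2] has a point common to both, so the small ball lies
   in [v] by the triangle inequality; symmetry is used to go from this point
   to the centre of the small ball. *)
Lemma owc_refine (u v : fball X) (d : met X) (C : PC) :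
  fb_le u v -> gle (sval (fb_met v)) (sval d) -> ple C (single u) ->
  sub_cov W C [set D | ple D C /\
    exists c, [/\ fb_met c = d, fb_le c v & ple D (single c)]].
Proof.
move=> /fb_leE[vu uv] vd Cu.
have /(cover_downset WP) := cover_le_trans WP Cu (owc_shrink u).
move/(is_cover_trans WP); apply=> D [DC [_ [u' [_ u'u] <-] Du']].
have /fb_ltE[uu' /cut_round[q lt uq]] := u'u.
set k := sval (fb_rad u) - sval (fb_rad u') - q.
have k0 : 0 < k / 2%:R by rewrite /k; lra.
have /(cover_downset WP) := owc_small D d (qpos k0).
move/(is_cover_trans WP); apply=> E [ED [_ [z _ <-] Ez]].
apply: owc_split => -[a aE]; apply: (is_cover_refl WP).
split; first exact: ple_trans ED DC.
exists (FBall d z (qpos k0)); split=> //.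
have /in_all_balls_fin1/fb_le_mem := in_all_balls_le (ple_trans ED Du') aE.
rewrite global_localK /fb_mem => /uu' u'a.
have /in_all_balls_fin1/fb_le_mem := in_all_balls_le Ez aE.
rewrite global_localK /fb_mem /= hX; last exact: svalP.
move=> /vd az.
apply/fb_leE; split=> //= t lt'.
(* [s] is what is left of [t] for the distance from [v] to [u] after the other three legs of the
   path. One half of [k] pays for the last leg, the other for the radius of the small ball, so the
   bound on [t] is exactly the one that [uv] needs for [s]. *)
pose s := t - k / 2%:R - sval (fb_rad u') - q.
have vu0 : cut (sval (fb_met v) (fb_ctr v) (fb_ctr u)) s.
  by apply: uv; rewrite /s /k in lt' *; lra.
have := cut_tri (cut_tri (cut_tri vu0 (vu _ _ _ uq)) (vu _ _ _ u'a)) az.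
by move=> H; apply: cut_up H _; rewrite /s; lra.
Qed.

Lemma single_le (a b : fball X) :
  fb_met a = fb_met b -> fb_le a b -> ple (single a) (single b).
Proof.
case: a b => [d x e] [d' y k] /= dd'; case: _ / dd' => ab.
by apply: prod_le_fin1; apply/global_le.
Qed.

(** The meet axiom of the product only concerns two balls of one factor, so [u] and [v] are first
    refined to balls of the supremum of their metrics. *)
Lemma owc_single_down (u v : fball X) (C : PC) :
  ple C (single u) -> ple C (single v) ->
  sub_cov W C [set single e | e in [set e | fb_le e u /\ fb_le e v]].
Proof.
move=> Cu Cv; pose d := met_sup (fb_met u) (fb_met v).
have [ud vd] : gle (sval (fb_met u)) (sval d) /\ gle (sval (fb_met v)) (sval d).
  by apply/gsupP; exact: gle_refl.
have /(is_cover_trans WP) := owc_refine (fb_le_refl u) ud Cu.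
apply=> D [DC [[d1 x e] [/= dE cu Dc]]].
have /(is_cover_trans WP) := owc_refine (fb_le_refl v) vd (ple_trans DC Cv).
apply=> E [ED [[d2 y k] [/= d'E cv Ec]]]; subst d1 d2.
apply: (cover_le_trans WP (prod_le_fin2 (ple_trans ED Dc) Ec)).
apply: (cover_sub WP (owc_ax_cov (prod_ax_down _ _))).
move=> _ [c [/global_le c1 /global_le c2] <-].
exists (global_ball c); last by rewrite /single local_globalK.
by split; [exact: fb_le_trans cu | exact: fb_le_trans cv].
Qed.

Lemma single_cov (a : S) U :
  cov a U -> sub_cov W (single a) [set single u | u in U].
Proof.
apply: (@gen_cov_least (fb_preord X) (@lc_ax X)
  (fun a U => sub_cov W (single a) [set single u | u in U])) => {a U}.
  split.
  - by move=> U a Ua; apply: (is_cover_refl WP); exists a.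
  - move=> a U V aU UV; apply: (is_cover_trans WP aU) => _ [u Uu <-].
    exact: UV.
  - move=> a U V aU aV; apply: (is_cover_trans WP (is_cover_down WP aU aV)).
    move=> C [_ [_ [[u Uu <-] [v Vv <-] Cu Cv]]].
    apply: (cover_sub WP (owc_single_down Cu Cv)) => _ [e [eu ev] <-].
    by exists e => //; exists u, v.
  (* [single a] need not lie below [single b] when the metrics differ; refining [a] into balls of
     the metric of [b] brings both into one factor. *)
  - move=> a b ab; have bb := @gle_refl _ (sval (fb_met b)).
    have /(is_cover_trans WP) := owc_refine ab bb (ple_refl (single a)).
    apply=> D [_ [c [cb cleb Dc]]].
    apply: (cover_le_sub WP (ple_trans Dc (single_le cb cleb))).
    by exists b.
move=> _ _ [a|a d e].
  apply: (cover_sub WP (owc_shrink a)) => _ [b [_ ba] <-].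
  by exists b.
apply: (cover_sub WP (owc_small (single a) d e)) => _ [x _ <-].
by exists (FBall d x e) => //; exists x.
Qed.

(** [B] is the meet of the singletons of its members. Each of these covers [single a] by
    [single_cov], and finitely many such covers combine through [down2]. *)
Lemma single_in_all_balls (a : S) (B : PC) :
  in_all_balls a B -> sub_cov W (single a) [set B].
Proof.
move=> aB; suff H : sub_cov W (single a)
    [set D | forall p, fin_set B p -> ple D (fin1 p : PC)].
  apply: (is_cover_trans WP H) => D DB; apply: (is_cover_le WP).
  by move=> i b /DB; apply.
move: aB; rewrite /in_all_balls; elim/fin_ind: (fin_set B) => [_|p Q IH aQ].
  exact: (is_cover_refl WP).
have ap : sub_cov W (single a) [set fin1 p].
  have := single_cov (is_cover_le (covP S) (aQ p (or_introl erefl))).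
  move/(cover_sub WP); apply=> _ [_ /= -> <-].
  by case: p {aQ} => i b; rewrite /single local_globalK.
have aD := IH (fun q Qq => aQ q (or_intror Qq)).
apply: (cover_sub WP (is_cover_down WP ap aD)).
move=> D [_ [E [/= -> EQ Dp DE]]] q [->|/EQ] //; exact: (prod_le_trans DE).
Qed.

(** A ball below all members of [A] is built one member at a time, with [owc_single_down] refining
    the ball found so far against the next member. *)
Lemma owc_local_base (A : PC) :
  sub_cov W A [set single c | c in [set c | in_all_balls c A]].
Proof.
(* With membership turned into inequalities, the induction runs over the finite set while [A] stays
   fixed. *)
have : forall p, fin_set A p -> ple A (single (global_ball (tagged p))).
  move=> [i b] Ap; rewrite /single local_globalK.
  by apply: prod_le_subset => _ ->.
rewrite /in_all_balls; elim/fin_ind: (fin_set A) => [_|p Q IH AQ].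
  (* With no member to respect, any ball will do: some metric exists, and the radius 1 is
     arbitrary. *)
  have [d Xd] := gus_inhabited X.
  have /(cover_sub WP) := owc_small A (exist _ d Xd) (qpos ltr01).
  by apply=> _ [x _ <-]; eexists.
have /(cover_downset WP)/(is_cover_trans WP) :=
  IH (fun q Qq => AQ q (or_intror Qq)).
apply=> D [DA [_ [c cQ <-] Dc]].
have Dp := ple_trans DA (AQ p (or_introl erefl)).
apply: (cover_sub WP (owc_single_down Dc Dp)) => _ [e [ec ep] <-].
by exists e => // q [->|/cQ] //; exact: fb_le_trans.
Qed.

(** Each ball [c] of the local base of [A] is covered in [U(X)] by the preimage of [U]; [single_cov]
    carries this cover to the product, and a ball related to [B] in [U] has its singleton covered by
    [B]. *)
Lemma image_owc A U : image_cov completion_map A U -> sub_cov W A U.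
Proof.
move=> AU; apply: (is_cover_trans WP (owc_local_base A)) => _ [c cA <-].
have /AU/single_cov/(is_cover_trans WP) : rpre in_all_balls [set A] c.
  by exists A.
apply=> _ [w [B UB wB] <-].
by apply: (cover_sub WP (single_in_all_balls wB)) => _ ->.
Qed.

End Embedding.

Theorem theorem3p19 (X : gus) (hX : gus_symmetric X) :
  exists2 V : set (prod_completion X),
    splitting V &
    exists2 r : ftmap (localic_completion X) (prod_completion X),
      is_embedding r & subtop_eq (image_subtop r) (overt_weakly_closed V).
Proof.
exists (@positive X); first exact: positive_splitting.
exists (completion_map X); first exact: completion_map_embedding.
by move=> A U; split; [exact: image_owc | exact: owc_image].
Qed.
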